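(* Let $d$ be a positive integer, $K$ a totally real number field, $(\Lambda, Q)$ a positive definite quadratic $\mathcal{O}_K$-lattice, and $a \in \mathcal{O}_K$. Then there exist only finitely many totally real number fields $L \supseteq K$ with $[L:K]=d$ such that $a \in Q(\mathcal{O}_L)$ but $a \notin Q(\mathcal{O}_{L'})$ for every proper subfield $L'$ of $L$ containing $K$.
   Context: For a number field $K$, $\mathcal{O}_K$ denotes its ring of integers. A quadratic $\mathcal{O}_K$-lattice is a pair $(\Lambda, Q)$ where $\Lambda$ is a finitely generated $\mathcal{O}_K$-submodule of a finite-dimensional $K$-vector space and $Q:\Lambda\to\mathcal{O}_K$ satisfies $Q(av)=a^2Q(v)$ for $a\in \mathcal{O}_K$, $v\in\Lambda$, with $(v,w)\mapsto Q(v+w)-Q(v)-Q(w)$ bilinear. It is positive definite (for $K$ totally real) if $Q(v)$ is totally positive for all nonzero $v\in\Lambda$. For an extension of integral domains $S\supseteq\mathcal{O}_K$, $Q(S)$ denotes the set of values of the unique quadratic map on $\Lambda\otimes_{\mathcal{O}_K} S$ extending $Q$. *)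

(* Defs.v *)
From HB Require Import structures.
From mathcomp Require Import all_boot all_order all_algebra all_field.
From mathcomp Require Import all_classical.
From mathcomp Require Import ring.

Set Implicit Arguments.
Unset Strict Implicit.
Unset Printing Implicit Defensive.

Import Order.TTheory GRing.Theory Num.Theory.
Local Open Scope classical_set_scope.
Local Open Scope ring_scope.

(* A number field is a [fieldExtType rat], and an extension of a number field
   [K] is a [fieldExtType K], whose intermediate fields are the terms of
   [{subfield L}].  Every embedding of a number field in the complex numbers
   lands in [algC], where [0 < z] means that [z] is real and positive. *)

Definition integers (F : fieldType) : set F :=
  [set x | integralOver (intr : int -> F) x].

Definition integers_in (K : fieldExtType rat) (L : fieldExtType K)
    (E : {vspace L}) : set L :=
  [set x | x \in E /\ integers x].

Definition totally_real (F : fieldType) : Prop :=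
  forall (s : {rmorphism F -> algC}) (x : F), s x \is Num.real.

Definition totally_positive (F : fieldType) (x : F) : Prop :=
  forall s : {rmorphism F -> algC}, 0 < s x.

Definition fin_gen_submodule (K : fieldExtType rat) (V : vectType K)
    (Lam : set V) : Prop :=
  exists (n : nat) (g : 'I_n -> V), forall v : V,
    Lam v <-> exists c : 'I_n -> K,
                (forall i, integers (c i)) /\ v = \sum_(i < n) c i *: g i.

Definition polar (V W : zmodType) (Q : V -> W) (v w : V) : W :=
  Q (v + w) - Q v - Q w.

(* Only the values of [Q] on [Lam] matter. *)
Record quadratic_lattice (K : fieldExtType rat) (V : vectType K)
    (Lam : set V) (Q : V -> K) : Prop := QuadraticLattice {
  ql_fin_gen : fin_gen_submodule Lam;
  ql_integral : forall v, Lam v -> integers (Q v);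
  ql_scale : forall a v, integers a -> Lam v -> Q (a *: v) = a ^+ 2 * Q v;
  ql_bilinearl : forall a u v w, integers a -> Lam u -> Lam v -> Lam w ->
    polar Q (a *: u + v) w = a * polar Q u w + polar Q v w;
  ql_bilinearr : forall a u v w, integers a -> Lam u -> Lam v -> Lam w ->
    polar Q w (a *: u + v) = a * polar Q w u + polar Q w v
}.

Definition positive_definite (K : fieldExtType rat) (V : vectType K)
    (Lam : set V) (Q : V -> K) : Prop :=
  forall v, Lam v -> v != 0 -> totally_positive (Q v).

(* For a subring [S] of [L] containing the integers of [K], the tensor product
   of [Lam] and [S] over the integers of [K] is presented by formal sums: the
   list [:: (v1, s1); ...; (vn, sn)] stands for the sum of the [vi (x) si], and
   two lists denote the same tensor when they are related by [tensor_eq]. *)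

Definition tensor (K : fieldExtType rat) (V : vectType K) (L : fieldExtType K)
    (Lam : set V) (S : set L) : set (seq (V * L)) :=
  [set x : seq (V * L) | forall p, p \in x -> Lam p.1 /\ S p.2].

Inductive tensor_eq (K : fieldExtType rat) (V : vectType K)
    (L : fieldExtType K) (Lam : set V) (S : set L) :
    seq (V * L) -> seq (V * L) -> Prop :=
| tensor_eq_refl x : tensor_eq Lam S x x
| tensor_eq_sym x y : tensor_eq Lam S x y -> tensor_eq Lam S y x
| tensor_eq_trans x y z :
    tensor_eq Lam S x y -> tensor_eq Lam S y z -> tensor_eq Lam S x z
| tensor_eq_cat x x' y y' : tensor_eq Lam S x x' -> tensor_eq Lam S y y' ->
    tensor_eq Lam S (x ++ y) (x' ++ y')
| tensor_eq_catC x y : tensor_eq Lam S (x ++ y) (y ++ x)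
| tensor_eq_addl v w s : Lam v -> Lam w -> S s ->
    tensor_eq Lam S [:: (v + w, s)] [:: (v, s); (w, s)]
| tensor_eq_addr v s t : Lam v -> S s -> S t ->
    tensor_eq Lam S [:: (v, s + t)] [:: (v, s); (v, t)]
| tensor_eq_balanced a v s : integers a -> Lam v -> S s ->
    tensor_eq Lam S [:: (a *: v, s)] [:: (v, a%:A * s)]
| tensor_eq_0 v : Lam v -> tensor_eq Lam S [:: (v, 0)] [::].

Definition tensor_scale (K : fieldExtType rat) (V : vectType K)
    (L : fieldExtType K) (c : L) (x : seq (V * L)) : seq (V * L) :=
  [seq (p.1, c * p.2) | p <- x].

Definition tensor_polar (K : fieldExtType rat) (V : vectType K)
    (L : fieldExtType K) (q : seq (V * L) -> L) (x y : seq (V * L)) : L :=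
  q (x ++ y) - q x - q y.

(* [q] induces a quadratic map on the tensor product, extending [Q]. *)
Record quadratic_extension (K : fieldExtType rat) (V : vectType K)
    (L : fieldExtType K) (Lam : set V) (Q : V -> K) (S : set L)
    (q : seq (V * L) -> L) : Prop := QuadraticExtension {
  qe_compat : forall x y, tensor Lam S x -> tensor Lam S y ->
    tensor_eq Lam S x y -> q x = q y;
  qe_integral : forall x, tensor Lam S x -> S (q x);
  qe_scale : forall c x, S c -> tensor Lam S x ->
    q (tensor_scale c x) = c ^+ 2 * q x;
  qe_bilinearl : forall c x y z, S c ->
    tensor Lam S x -> tensor Lam S y -> tensor Lam S z ->
    tensor_polar q (tensor_scale c x ++ y) z =
      c * tensor_polar q x z + tensor_polar q y z;
  qe_bilinearr : forall c x y z, S c ->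
    tensor Lam S x -> tensor Lam S y -> tensor Lam S z ->
    tensor_polar q z (tensor_scale c x ++ y) =
      c * tensor_polar q z x + tensor_polar q z y;
  qe_extends : forall v, Lam v -> q [:: (v, 1)] = (Q v)%:A
}.

(* The set Q(S).  By [quadratic_extension_tensor_form] and
   [quadratic_extension_unique] below, [q] exists and
   is uniquely determined on [tensor Lam S]. *)
Definition quadratic_values (K : fieldExtType rat) (V : vectType K)
    (L : fieldExtType K) (Lam : set V) (Q : V -> K) (S : set L) : set L :=
  [set b | exists q : seq (V * L) -> L,
     quadratic_extension Lam Q S q /\ exists2 x, tensor Lam S x & q x = b].

Fixpoint tensor_form (K : fieldExtType rat) (V : vectType K)
    (L : fieldExtType K) (Q : V -> K) (x : seq (V * L)) : L :=
  if x is p :: x' then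
    p.2 ^+ 2 * (Q p.1)%:A
    + \sum_(r <- x') p.2 * r.2 * (polar Q p.1 r.1)%:A
    + tensor_form Q x'
  else 0.

Definition overring (K : fieldExtType rat) (L : fieldExtType K)
    (S : set L) : Prop :=
  [/\ forall a : K, integers a -> S a%:A,
      forall x y, S x -> S y -> S (x - y)
    & forall x y, S x -> S y -> S (x * y)].

Lemma integers0 (F : fieldType) : integers (0 : F).
Proof. exact: integral0. Qed.

Lemma integers1 (F : fieldType) : integers (1 : F).
Proof. exact: integral1. Qed.

Lemma integersB (F : fieldType) (x y : F) :
  integers x -> integers y -> integers (x - y).
Proof. exact: integral_sub. Qed.

Lemma integersD (F : fieldType) (x y : F) :
  integers x -> integers y -> integers (x + y).
Proof. exact: integral_add. Qed.

Lemma integersM (F : fieldType) (x y : F) :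
  integers x -> integers y -> integers (x * y).
Proof. exact: integral_mul. Qed.

Lemma integers_in_overring (K : fieldExtType rat) (L : fieldExtType K)
  (E : {subfield L}) : overring (integers_in E).
Proof.
split.
- move=> a [p mon_p pa0]; split; first by rewrite rpredZ ?mem1v.
  exists p => //; have -> : map_poly (intr : int -> L) p
      = map_poly (in_alg L) (map_poly (intr : int -> K) p).
    by rewrite -map_poly_comp; apply: eq_map_poly => z; rewrite /= scaler_int.
  exact: rmorph_root.
- by move=> x y [Ex Ix] [Ey Iy]; split; [rewrite rpredB | apply: integersB].
- by move=> x y [Ex Ix] [Ey Iy]; split; [rewrite rpredM | apply: integersM].
Qed.

Lemma fin_gen_submodule_closed (K : fieldExtType rat) (V : vectType K)
  (Lam : set V) (Lfg : fin_gen_submodule Lam) :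
  Lam 0 /\ forall a u v, integers a -> Lam u -> Lam v -> Lam (a *: u + v).
Proof.
case: Lfg => n [g Lg]; split.
  apply/Lg; exists (fun=> 0); split; first by move=> i; apply: integers0.
  by rewrite big1 // => i _; rewrite scale0r.
move=> a u v Ia /Lg[c [Ic ->]] /Lg[e [Ie ->]]; apply/Lg.
exists (fun i => a * c i + e i); split.
  by move=> i; apply: integersD => //; apply: integersM.
rewrite scaler_sumr -big_split /=; apply: eq_bigr => i _.
by rewrite scalerDl scalerA.
Qed.

Definition tensor_cross (K : fieldExtType rat) (V : vectType K)
    (L : fieldExtType K) (Q : V -> K) (x y : seq (V * L)) : L :=
  \sum_(p <- x) \sum_(r <- y) p.2 * r.2 * (polar Q p.1 r.1)%:A.

Lemma polarC (V W : zmodType) (Q : V -> W) v w : polar Q v w = polar Q w v.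
Proof. by rewrite /polar [v + w]addrC addrAC. Qed.

Lemma tensor_crossC (K : fieldExtType rat) (V : vectType K)
  (L : fieldExtType K) (Q : V -> K) (x y : seq (V * L)) :
  tensor_cross Q x y = tensor_cross Q y x.
Proof.
rewrite /tensor_cross exchange_big /=; apply: eq_bigr => p _.
by apply: eq_bigr => r _; rewrite [r.2 * _]mulrC polarC.
Qed.

Lemma tensor_cross_cat (K : fieldExtType rat) (V : vectType K)
  (L : fieldExtType K) (Q : V -> K) (x y z : seq (V * L)) :
  tensor_cross Q (x ++ y) z = tensor_cross Q x z + tensor_cross Q y z.
Proof. by rewrite /tensor_cross big_cat. Qed.

Lemma tensor_cross_scale (K : fieldExtType rat) (V : vectType K)
  (L : fieldExtType K) (Q : V -> K) c (x z : seq (V * L)) :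
  tensor_cross Q (tensor_scale c x) z = c * tensor_cross Q x z.
Proof.
rewrite /tensor_cross big_map mulr_sumr; apply: eq_bigr => p _ /=.
by rewrite mulr_sumr; apply: eq_bigr => r _; rewrite !mulrA.
Qed.

Lemma tensor_form_cat (K : fieldExtType rat) (V : vectType K)
  (L : fieldExtType K) (Q : V -> K) (x y : seq (V * L)) :
  tensor_form Q (x ++ y)
  = tensor_form Q x + tensor_form Q y + tensor_cross Q x y.
Proof.
elim: x => [|p x IHx] /=; first by rewrite /tensor_cross big_nil add0r addr0.
rewrite IHx big_cat /= /tensor_cross big_cons -!addrA; congr (_ + (_ + _)).
by ring.
Qed.

Lemma tensor_form_polar (K : fieldExtType rat) (V : vectType K)
  (L : fieldExtType K) (Q : V -> K) (x y : seq (V * L)) :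
  tensor_polar (tensor_form Q) x y = tensor_cross Q x y.
Proof. by rewrite /tensor_polar tensor_form_cat; ring. Qed.

Lemma tensor_form_scale (K : fieldExtType rat) (V : vectType K)
  (L : fieldExtType K) (Q : V -> K) c (x : seq (V * L)) :
  tensor_form Q (tensor_scale c x) = c ^+ 2 * tensor_form Q x.
Proof.
elim: x => [|p x IHx] /=; first by rewrite mulr0.
rewrite IHx !mulrDr big_map mulr_sumr exprMn; congr (_ + _ + _); first by ring.
by apply: eq_bigr => r _ /=; ring.
Qed.

Lemma tensor_catE (K : fieldExtType rat) (V : vectType K)
  (L : fieldExtType K) (Lam : set V) (S : set L) x y :
  tensor Lam S (x ++ y) <-> tensor Lam S x /\ tensor Lam S y.
Proof.
split=> [H|[Hx Hy] p]; last by rewrite mem_cat => /orP[/Hx|/Hy].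
by split=> p px; apply: H; rewrite mem_cat px ?orbT.
Qed.

Lemma tensor_seq1E (K : fieldExtType rat) (V : vectType K)
  (L : fieldExtType K) (Lam : set V) (S : set L) v s :
  tensor Lam S [:: (v, s)] <-> Lam v /\ S s.
Proof.
by split=> [/(_ (v, s))|[Lv Ss] p]; rewrite inE ?eqxx; [exact|move=> /eqP->].
Qed.

Section QuadraticExtension.

Context (K : fieldExtType rat) (V : vectType K) (L : fieldExtType K).
Context (Lam : set V) (Q : V -> K) (S : set L).
Hypotheses (LamQ : quadratic_lattice Lam Q) (Sring : overring S).

Let Lam0 : Lam 0.
Proof. by case: (fin_gen_submodule_closed (ql_fin_gen LamQ)). Qed.

Let LamP a u v : integers a -> Lam u -> Lam v -> Lam (a *: u + v).
Proof. by case: (fin_gen_submodule_closed (ql_fin_gen LamQ)) => _; apply. Qed.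

Let LamD u v : Lam u -> Lam v -> Lam (u + v).
Proof.
by move=> Lu Lv; rewrite -[u]scale1r; apply: LamP => //; apply: integers1.
Qed.

Let LamZ a u : integers a -> Lam u -> Lam (a *: u).
Proof. by move=> Ia Lu; rewrite -[_ *: _]addr0; apply: LamP. Qed.

Let SA a : integers a -> S a%:A. Proof. by case: Sring => H _ _; apply: H. Qed.
Let SB x y : S x -> S y -> S (x - y).
Proof. by case: Sring => _ H _; apply: H. Qed.
Let SM x y : S x -> S y -> S (x * y). Proof. by case: Sring => _ _; apply. Qed.
Let S0 : S 0. Proof. by rewrite -(scale0r 1); apply/SA/integers0. Qed.
Let S1 : S 1. Proof. by rewrite -(scale1r 1); apply/SA/integers1. Qed.
Let SD x y : S x -> S y -> S (x + y).
Proof. by move=> Sx Sy; rewrite -[y]opprK -[- y]sub0r; do 2?apply: SB. Qed.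

Let polarD u v w : Lam u -> Lam v -> Lam w ->
  polar Q (u + v) w = polar Q u w + polar Q v w.
Proof.
move=> Lu Lv Lw; rewrite -{1}[u]scale1r (ql_bilinearl LamQ) ?mul1r //.
exact: integers1.
Qed.

Let polar0 w : Lam w -> polar Q 0 w = 0.
Proof. by move=> Lw; apply: (addrI (polar Q 0 w)); rewrite -polarD ?addr0. Qed.

Let polarZ a u w : integers a -> Lam u -> Lam w ->
  polar Q (a *: u) w = a * polar Q u w.
Proof.
by move=> Ia Lu Lw; rewrite -[_ *: _]addr0 (ql_bilinearl LamQ) // polar0 ?addr0.
Qed.

Let polar_diag v : Lam v -> polar Q v v = 2 * Q v.
Proof.
move=> Lv; rewrite /polar -mulr2n -scaler_nat (ql_scale LamQ) //.
  by ring.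
exact: integral_nat.
Qed.

Let polar_int v w : Lam v -> Lam w -> integers (polar Q v w).
Proof.
move=> Lv Lw; do 2?apply: integersB; apply: (ql_integral LamQ) => //.
by apply: LamD.
Qed.

Lemma tensor_eq_tensor x y :
  tensor_eq Lam S x y -> (tensor Lam S x <-> tensor Lam S y).
Proof.
elim=> {x y}.
- by [].
- by move=> x y _ [].
- by move=> x y z _ [? ?] _ [? ?]; split; auto.
- by move=> x x' y y' _ [? ?] _ [? ?]; rewrite !tensor_catE; split=> -[]; auto.
- by move=> x y; rewrite !tensor_catE; split=> -[].
- move=> v w s Lv Lw Ss; rewrite (tensor_catE _ _ [:: _] [:: _]) !tensor_seq1E.
  by split=> _ //; split => //; apply: LamD.
- move=> v s t Lv Ss St; rewrite (tensor_catE _ _ [:: _] [:: _]) !tensor_seq1E.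
  by split=> _ //; split => //; apply: SD.
- move=> a v s Ia Lv Ss; rewrite !tensor_seq1E; split=> _; split=> //.
    by apply: SM => //; apply: SA.
  exact: LamZ.
- by move=> v Lv; rewrite tensor_seq1E; split.
Qed.

Lemma tensor_cross_compat x y z : tensor Lam S z -> tensor_eq Lam S x y ->
  tensor_cross Q x z = tensor_cross Q y z.
Proof.
move=> Hz; elim=> {x y}.
- by [].
- by [].
- by move=> x y t _ -> _ ->.
- by move=> x x' y y' _ e _ e'; rewrite !tensor_cross_cat e e'.
- by move=> x y; rewrite !tensor_cross_cat addrC.
- move=> v w s Lv Lw Ss; rewrite /tensor_cross !(big_cons, big_nil) !addr0.
  rewrite -big_split /=; apply: eq_big_seq => r /Hz[Lr _].
  by rewrite polarD // scalerDl mulrDr.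
- move=> v s t Lv Ss St; rewrite /tensor_cross !(big_cons, big_nil) !addr0.
  by rewrite -big_split /=; apply: eq_bigr => r _; rewrite !mulrDl.
- move=> a v s Ia Lv Ss; rewrite /tensor_cross !(big_cons, big_nil) !addr0.
  apply: eq_big_seq => r /Hz[Lr _] /=.
  by rewrite polarZ // -!scalerAl mul1r -!scalerAr !scalerA mulrC.
- move=> v Lv; rewrite /tensor_cross !(big_cons, big_nil) addr0.
  by apply: big1 => r _ /=; rewrite !mul0r.
Qed.

Lemma tensor_form_compat x y : tensor Lam S x -> tensor_eq Lam S x y ->
  tensor_form Q x = tensor_form Q y.
Proof.
move=> Hx exy; elim: exy Hx => {x y}.
- by [].
- by move=> x y /tensor_eq_tensor[_ H] e /H /e.
- move=> x y z /tensor_eq_tensor[H _] e _ e' Hx.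
  by rewrite e // e' //; apply: H.
- move=> x x' y y' ex e ey e' /tensor_catE[Hx Hy]; rewrite !tensor_form_cat.
  rewrite e // e' //; congr (_ + _); rewrite (tensor_cross_compat Hy ex).
  rewrite tensor_crossC [RHS]tensor_crossC; apply: tensor_cross_compat ey.
  by case: (tensor_eq_tensor ex) => H _; apply: H.
- move=> x y _; rewrite !tensor_form_cat tensor_crossC; congr (_ + _).
  by rewrite addrC.
- move=> v w s Lv Lw Ss _ /=; rewrite !(big_cons, big_nil) /= !addr0.
  have -> : Q (v + w) = Q v + polar Q v w + Q w.
    by rewrite /polar; ring.
  by rewrite !scalerDl; ring.
- move=> v s t Lv Ss St _ /=; rewrite !(big_cons, big_nil) /= !addr0.
  by rewrite polar_diag // mulr_natl -scalerMnl; ring.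
- move=> a v s Ia Lv Ss _ /=; rewrite !(big_cons, big_nil) /= !addr0.
  rewrite (ql_scale LamQ) // -[(_ * Q v)%:A]/(in_alg L _) rmorphM rmorphXn /=.
  by ring.
- by move=> v Lv _ /=; rewrite big_nil expr0n mul0r !addr0.
Qed.

Lemma quadratic_extension_tensor_form :
  quadratic_extension Lam Q S (tensor_form Q).
Proof.
split.
- by move=> x y Hx _; apply: tensor_form_compat.
- elim=> [//|[v s] x IHx] /(tensor_catE _ _ [:: _])[/tensor_seq1E[Lv Ss] Hx] /=.
  apply: SD; last exact: IHx.
  apply: SD.
    by rewrite expr2; do 2?apply: SM => //; apply/SA/(ql_integral LamQ).
  rewrite big_seq; elim/big_ind: _ => //.
  by move=> r /Hx[Lr Sr]; do 2?apply: SM => //; apply/SA/polar_int.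
- by move=> c x _ _; apply: tensor_form_scale.
- move=> c x y z _ _ _ _.
  by rewrite !tensor_form_polar tensor_cross_cat tensor_cross_scale.
- move=> c x y z _ _ _ _; rewrite !tensor_form_polar !(tensor_crossC Q z).
  by rewrite tensor_cross_cat tensor_cross_scale.
- by move=> v Lv /=; rewrite big_nil !addr0 expr1n mul1r.
Qed.

Lemma quadratic_extension_unique q : quadratic_extension Lam Q S q ->
  forall x, tensor Lam S x -> q x = tensor_form Q x.
Proof.
move=> qQ.
have T0 : tensor Lam S [::] by [].
have q0 : q [::] = 0.
  by rewrite -[[::]]/(tensor_scale 0 [::]) (qe_scale qQ) // expr0n mul0r.
have polar_q0 x : tensor_polar q x [::] = 0.
  by rewrite /tensor_polar cats0 subrr q0 subr0.
have q1 v s : Lam v -> S s -> q [:: (v, s)] = s ^+ 2 * (Q v)%:A.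
  move=> Lv Ss; rewrite -(qe_extends qQ) // -(qe_scale qQ) ?tensor_seq1E //.
  by rewrite /tensor_scale /= mulr1.
have b1 v w : Lam v -> Lam w ->
    tensor_polar q [:: (v, 1)] [:: (w, 1)] = (polar Q v w)%:A.
  move=> Lv Lw; rewrite /tensor_polar /= /polar !scalerBl -!(qe_extends qQ) //.
    congr (_ - _ - _); apply/esym/(qe_compat qQ).
    - by apply/tensor_seq1E; split; [apply: LamD|].
    - by apply/(tensor_catE _ _ [:: _] [:: _]); rewrite !tensor_seq1E.
    - exact: tensor_eq_addl.
  exact: LamD.
have bZl s x y : S s -> tensor Lam S x -> tensor Lam S y ->
    tensor_polar q (tensor_scale s x) y = s * tensor_polar q x y.
  move=> Ss Hx Hy; rewrite -[tensor_scale s x]cats0 (qe_bilinearl qQ) //.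
  by rewrite /tensor_polar /= q0 subr0 subrr addr0.
have bZr s x y : S s -> tensor Lam S x -> tensor Lam S y ->
    tensor_polar q y (tensor_scale s x) = s * tensor_polar q y x.
  move=> Ss Hx Hy; rewrite -[tensor_scale s x]cats0 (qe_bilinearr qQ) //.
  by rewrite polar_q0 addr0.
have bsum v s x : Lam v -> S s -> tensor Lam S x ->
    tensor_polar q [:: (v, s)] x
    = \sum_(r <- x) s * r.2 * (polar Q v r.1)%:A.
  move=> Lv Ss; elim: x => [|[w t] x IHx]; first by rewrite polar_q0 big_nil.
  move=> /(tensor_catE _ _ [:: _])[/tensor_seq1E[Lw St] Hx].
  have -> : (w, t) :: x = tensor_scale t [:: (w, 1)] ++ x.
    by rewrite /tensor_scale /= mulr1.
  rewrite (qe_bilinearr qQ) ?tensor_seq1E // IHx // big_cat /=; congr (_ + _).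
  rewrite big_seq1 /= mulr1 -b1 //.
  have -> : [:: (v, s)] = tensor_scale s [:: (v, 1 : L)].
    by rewrite /tensor_scale /= mulr1.
  by rewrite bZl ?tensor_seq1E // mulrA [t * s]mulrC.
elim=> [//|[v s] x IHx] /(tensor_catE _ _ [:: _])[/[dup] Hp].
move=> /tensor_seq1E[Lv Ss] Hx /=.
rewrite -bsum // -q1 // -IHx // /tensor_polar /=.
by ring.
Qed.

Lemma quadratic_valuesE :
  quadratic_values Lam Q S
  = [set b | exists2 x, tensor Lam S x & tensor_form Q x = b].
Proof.
apply/seteqP; split=> b.
  move=> [q [qQ [x Hx <-]]]; exists x => //.
  by rewrite (quadratic_extension_unique qQ).
move=> Hb; exists (tensor_form Q); split=> //.
exact: quadratic_extension_tensor_form.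
Qed.

End QuadraticExtension.

(* Main.v *)
(* A tensor with value [a] is a vector [u] of algebraic integers, its
   coefficients on generators [g] of the lattice; they are not unique.  A
   finitely generated torsion-free module over the integers of [K] is
   projective, so some integral matrix [T] with [T g = g] kills every relation
   between the generators, and [s = u T] represents the same tensor.  Each
   entry of [s] is the pairing of the tensor with a fixed vector over [K], so
   positive definiteness bounds all its conjugates in terms of [a].  There are
   finitely many algebraic integers of bounded degree with bounded conjugates.
   Finally [a] is already represented over the subfield generated over [K] by
   the entries of [s], which by minimality is all of [L]. *)

Require Import Defs.
From HB Require Import structures.
From mathcomp Require Import all_boot all_order all_algebra all_field.
From mathcomp Require Import all_classical.
From mathcomp Require Import ring zify.

Set Implicit Arguments.
Unset Strict Implicit.
Unset Printing Implicit Defensive.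
Import Order.TTheory GRing.Theory Num.Theory.
Local Open Scope classical_set_scope.
Local Open Scope ring_scope.

(** * Finitely generated modules over the algebraic integers *)

Lemma integers_fmorph (F E : fieldType) (f : {rmorphism F -> E}) (x : F) :
  integers (f x) <-> integers x.
Proof.
have mapf (p : {poly int}) :
    map_poly (intr : int -> E) p = map_poly f (map_poly (intr : int -> F) p).
  by rewrite -map_poly_comp; apply: eq_map_poly => z /=; rewrite rmorph_int.
split=> -[p mon_p]; first by rewrite mapf fmorph_root; exists p.
by move=> px0; exists p; rewrite // mapf rmorph_root.
Qed.

Lemma integersN (F : fieldType) (x : F) : integers x -> integers (- x).
Proof. exact: integral_opp. Qed.

Lemma integersX (F : fieldType) (x : F) n : integers x -> integers (x ^+ n).
Proof.
move=> Ix; elim: n => [|n IHn]; first exact: integers1.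
by rewrite exprS; apply: integersM.
Qed.

Lemma integers_int (F : fieldType) (z : int) : integers (z%:~R : F).
Proof. exact: integral_id. Qed.

Lemma integers_sum (F : fieldType) (I : Type) (r : seq I) (P : pred I)
    (E : I -> F) :
  (forall i, P i -> integers (E i)) -> integers (\sum_(i <- r | P i) E i).
Proof.
by move=> IE; elim/big_ind: _ => //; [apply: integers0 | apply: integersD].
Qed.

(** With [c] the leading coefficient and n + 1 the degree, c^n p(X) is a monic polynomial in c X
    with integral coefficients, so [c * r] is integral over integral elements. *)
Lemma integers_lead_coef_root (F : fieldType) (p : {poly F}) (r : F) :
  (forall i, integers p`_i) -> root p r -> integers (lead_coef p * r).
Proof.
move=> Ip pr0; have [->|p_neq0] := eqVneq p 0.
  by rewrite lead_coef0 mul0r; apply: integers0.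
have := root_size_gt1 p_neq0 pr0; case Dn: (size p) => [|[|n]] // _.
set c := lead_coef p.
have cE : c = p`_n.+1 by rewrite /c lead_coefE Dn.
pose s := \poly_(i < n.+1) (c ^+ (n - i) * p`_i).
apply: (@integral_root_monic _ _ _ _ ('X^(n.+1) + s)).
- rewrite monicE lead_coefDl ?lead_coefXn // size_polyXn ltnS.
  exact: size_poly.
- apply/rootP; rewrite hornerD hornerXn horner_poly.
  transitivity (c ^+ n * p.[r]); last by rewrite (rootP pr0) mulr0.
  rewrite horner_coef Dn [in RHS]big_ord_recr /= -cE mulrDr addrC.
  congr (_ + _).
    rewrite mulr_sumr; apply: eq_bigr => i _.
    have -> : c ^+ n = c ^+ (n - i) * c ^+ i.
      by rewrite -exprD subnK // -ltnS ltn_ord.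
    by rewrite exprMn -!mulrA; congr (_ * _); rewrite mulrCA.
  by rewrite exprMn exprSr mulrA.
- apply/integral_poly => i; rewrite coefD coefXn coef_poly.
  apply: integersD; first exact: integral_nat.
  case: ifP => _; last exact: integers0.
  by apply: integersM => //; apply: integersX; rewrite cE.
Qed.

(** By induction on the size of [q]: its leading coefficient [c] and, by the previous lemma, [c * r]
    are integral, so subtracting c X^m (X - r) from the product strips the leading term of [q] and
    keeps every coefficient integral. *)
Lemma integers_coef_divXsubC (F : fieldType) (q : {poly F}) (r : F) :
    (forall i, integers (q * ('X - r%:P))`_i) -> forall i, integers q`_i.
Proof.
have [n] := ubnP (size q); elim: n q => // n IHn q /ltnSE le_qn Ip.
have [-> i|q_neq0] := eqVneq q 0; first by rewrite coef0; apply: integers0.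
set p := q * _ in Ip; set c := lead_coef q; set m := (size q).-1.
have cp : lead_coef p = c by rewrite lead_coef_Mmonic ?monicXsubC.
have Icr : integers (c * r).
  rewrite -cp; apply: integers_lead_coef_root => //.
  by rewrite rootM root_XsubC eqxx orbT.
have Ic : integers c by rewrite -cp; apply: Ip.
pose q' := q - c *: 'X^m.
have qE : q = q' + c *: 'X^m by rewrite subrK.
suff Iq' i : integers q'`_i.
  move=> i; rewrite qE coefD coefZ coefXn; apply: integersD => //.
  by apply: integersM => //; apply: integral_nat.
apply: IHn.
  apply: leq_trans le_qn.
  have sz : (size q' <= size q)%N.
    rewrite (leq_trans (size_polyD _ _)) // geq_max leqnn size_polyN.
    rewrite (leq_trans (size_scale_leq _ _)) // size_polyXn.
    by rewrite /m prednK ?size_poly_gt0.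
  rewrite ltn_neqAle sz andbT; apply/negP => /eqP szE.
  have q'0 : q' != 0 by rewrite -size_poly_eq0 szE size_poly_eq0.
  move: q'0; rewrite -lead_coef_eq0 lead_coefE szE coefB coefZ coefXn eqxx.
  by rewrite mulr1 -lead_coefE subrr eqxx.
move=> k.
have -> : q' * ('X - r%:P) = p - c *: 'X^(m.+1) + (c * r) *: 'X^m.
  rewrite /q' mulrBl -/p -addrA; congr (_ + _).
  rewrite mulrBr opprB [RHS]addrC; congr (_ - _).
    by rewrite mulrC mul_polyC scalerA mulrC.
  by rewrite -scalerAl exprSr.
rewrite coefD coefB !coefZ !coefXn; apply: integersD.
  apply: integersB => //.
  by apply: integersM => //; apply: integral_nat.
by apply: integersM => //; apply: integral_nat.
Qed.

(* Dedekind's "Prague theorem".  Stripping one root [r] off [f = f' (X - r)],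
   both [f'_i g] and [f'_i (X - r) g] are integral, hence so is [r f'_i g]. *)
Lemma integers_coef_mul (f g : {poly algC}) :
  (forall k, integers (f * g)`_k) -> forall i j, integers (f`_i * g`_j).
Proof.
have [s ->] := closed_field_poly_normal f; move: (lead_coef f) => c {f}.
elim: s g => [|r s IHs] g Ifg i j.
  rewrite big_nil alg_polyC coefC.
  case: eqP => _; last by rewrite mul0r; apply: integers0.
  by have := Ifg j; rewrite big_nil alg_polyC coefCM.
move: Ifg IHs; rewrite big_cons [_ * \prod_(_ <- _) _]mulrC scalerAl.
set f' := c *: _ => Ifg IHs.
have If'g k l : integers (f'`_k * g`_l).
  apply: IHs; apply: (@integers_coef_divXsubC _ _ r) => l'.
  by rewrite mulrAC.
have Irf'g k l : integers (r * f'`_k * g`_l).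
  have H : integers (f'`_k * (('X - r%:P) * g)`_l).
    by apply: IHs => l'; rewrite mulrA.
  have -> : r * f'`_k * g`_l
      = f'`_k * ('X * g)`_l - f'`_k * (('X - r%:P) * g)`_l.
    by rewrite mulrBl coefB coefCM mulrBr subKr mulrCA mulrA.
  apply: integersB => //; rewrite coefXM; case: eqP => _ //.
  by rewrite mulr0; apply: integers0.
rewrite mulrBr coefB coefMX coefMC mulrBl; apply: integersB.
  by case: eqP => _ //; rewrite mul0r; apply: integers0.
by rewrite [f'`_i * r]mulrC.
Qed.

(** Supplies the content of an integer polynomial together with a Bezout relation for it. *)
Lemma bezout_int (m : nat) (s : nat -> int) :
  exists (u : nat -> int) (g : int),
    \sum_(i < m) u i * s i = g /\ forall i, (i < m)%N -> (g %| s i)%Z.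
Proof.
elim: m => [|m [u [g [Eg dvg]]]].
  by exists (fun=> 0), 0; rewrite big_ord0.
have [a [b Eab]] := Bezoutz g (s m).
exists (fun i => if (i < m)%N then a * u i else b), (gcdz g (s m)); split.
  rewrite big_ord_recr /= ltnn -Eab -Eg mulr_sumr; congr (_ + _).
  by apply: eq_bigr => i _; rewrite ltn_ord mulrA.
move=> i; rewrite ltnS leq_eqVlt => /predU1P[->|/dvg]; first exact: dvdz_gcdr.
exact/dvdz_trans/dvdz_gcdl.
Qed.

(** Over [algC] the polynomial splits; the product of the rational minimal polynomials of its roots
    is a multiple of it, and clearing denominators makes that multiple integral. *)
Lemma dvdp_int_poly (K : fieldType) (iota : {rmorphism K -> algC})
    (f : {poly K}) : f != 0 ->
  exists2 h : {poly int}, h != 0 & f %| map_poly intr h.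
Proof.
move=> f_neq0; have [r Dr] := closed_field_poly_normal (map_poly iota f).
pose q := \prod_(z <- r) sval (minCpolyP z).
have qE : map_poly ratr q = \prod_(z <- r) minCpoly z.
  by rewrite rmorph_prod; apply: eq_bigr => z _ /=; case: minCpolyP => p [[]].
have dvq : map_poly iota f %| map_poly ratr q.
  rewrite Dr dvdpZl ?lead_coef_eq0 ?map_poly_eq0 // qE.
  apply: (big_ind2 (fun a b : {poly algC} => a %| b)) => // [a b a' b'|z _].
    exact: dvdp_mul.
  by rewrite dvdp_XsubCl root_minCpoly.
have q_neq0 : q != 0.
  rewrite -(map_poly_eq0 (ratr : rat -> algC)) qE; elim/big_ind: _ => //.
  - exact: oner_neq0.
  - exact: mulf_neq0.
  - by move=> z _; rewrite minCpoly_eq0.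
have [h [a a_neq0 Dq]] := rat_poly_scale q.
exists h.
  by apply: contra_neq q_neq0 => h0; rewrite Dq h0 rmorph0 scaler0.
rewrite -(dvdp_map iota) -map_poly_comp.
have -> : map_poly (iota \o intr) h
    = map_poly (ratr : rat -> algC) (map_poly intr h).
  by rewrite -map_poly_comp; apply: eq_map_poly => z /=; rewrite !rmorph_int.
move: dvq; rewrite Dq map_polyZ /= dvdpZr //.
by rewrite fmorph_eq0 invr_eq0 intr_eq0.
Qed.

(* Inverting the ideal generated by the entries of [c]: the polynomial with
   coefficients [c] has a multiple with coprime integer coefficients, and by the
   Prague theorem the coefficients of the cofactor lie in the inverse ideal. *)
Lemma ideal_invertible (K : fieldType) (iota : {rmorphism K -> algC}) n
    (c : 'cV[K]_n) : c != 0 ->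
  exists2 b : 'rV[K]_n, forall i j, integers ((c *m b) i j) & b *m c = 1%:M.
Proof.
move=> c_neq0; pose f := rVpoly c^T.
have f_neq0 : f != 0.
  apply: contra_neq c_neq0 => f0.
  by rewrite -[c]trmxK -[c^T]rVpolyK -/f f0 linear0 trmx0.
have [h h_neq0 /dvdpP[g0 Dg0]] := dvdp_int_poly iota f_neq0.
have [u [e [Ee dve]]] := bezout_int (size h) (nth 0 h).
have e_neq0 : e != 0.
  apply: contra_neq h_neq0 => e0; apply/polyP => i; rewrite coef0.
  have [/dve|lehi] := ltnP i (size h); last exact: nth_default.
  by rewrite e0 dvd0z => /eqP.
have eF_neq0 : e%:~R != 0 :> K.
  by rewrite -(fmorph_eq0 iota) rmorph_int intr_eq0.
(* Dividing the cofactor by the content [e] turns the coefficients of [f * g] into the coprime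
   integers h_k / e. *)
pose g := e%:~R^-1 *: g0.
have fgE k : (f * g)`_k = (h`_k %/ e)%Z%:~R.
  rewrite mulrC -scalerAl -Dg0 coefZ coef_map /=.
  apply: (canLR (mulKf eF_neq0)); rewrite -intrM mulrC divzK //.
  have [/dve//|lehi] := ltnP k (size h); rewrite nth_default ?dvdz0 //.
have Ifg i j : integers (f`_i * g`_j).
  apply/(integers_fmorph iota); rewrite rmorphM -!(coef_map iota).
  apply: integers_coef_mul => k; rewrite -rmorphM coef_map /= fgE rmorph_int.
  exact: integers_int.
(* The coefficient of X^k in [f * g] is the sum of the c_j g_(k - j), so [b *m c] is the sum of the
   u_k h_k / e, which is 1. *)
pose b := \row_j \sum_(k < size h) (u k)%:~R * ('X^j * g)`_k : 'rV_n.
exists b.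
  move=> i j; rewrite !mxE big_ord1 !mxE mulr_sumr.
  apply: integers_sum => k _; rewrite mulrCA; apply: integersM.
    exact: integers_int.
  rewrite coefXnM; case: ifP => _; first by rewrite mulr0; apply: integers0.
  by have := Ifg i (k - j)%N; rewrite /f coef_rVpoly_ord mxE.
apply/matrixP => i j; rewrite !ord1 !mxE /=.
under eq_bigr do rewrite !mxE mulr_suml.
rewrite exchange_big /=.
transitivity (\sum_(k < size h) (u k)%:~R * (f * g)`_k).
  apply: eq_bigr => k _; have -> : f = \sum_(l < n) c l 0 *: 'X^l.
    rewrite /f /rVpoly poly_def; apply: eq_bigr => l _.
    rewrite insubT //= => ltl; rewrite mxE.
    by congr (c _ 0 *: _); apply: val_inj.
  rewrite mulr_suml coef_sum mulr_sumr; apply: eq_bigr => l _.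
  by rewrite -scalerAl coefZ -mulrA; congr (_ * _); rewrite mulrC.
apply: (mulIf eF_neq0); rewrite mulr_suml mul1r.
transitivity ((\sum_(k < size h) u k * h`_k)%:~R : K); last by rewrite Ee.
rewrite rmorph_sum /=.
apply: eq_bigr => k _; rewrite fgE -mulrA -intrM divzK ?rmorphM //.
exact: dve.
Qed.

(* That is, a finitely generated torsion-free module over the integers is
   projective; [G] lists the coordinates of the generators. *)
Lemma integers_projector (K : fieldType) (iota : {rmorphism K -> algC}) r n
    (G : 'M[K]_(n, r)) :
  exists2 P : 'M[K]_(r, n),
    forall i j, integers ((G *m P) i j) & G *m P *m G = G.
Proof.
elim: r G => [|r IHr] G.
  exists 0; last by rewrite [LHS]thinmx0 [RHS]thinmx0.
  by move=> i j; rewrite mulmx0 mxE; apply: integers0.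
rewrite -[r.+1]/(1 + r)%N in G *; rewrite -[G](@hsubmxK _ n 1 r).
move: (lsubmx _) (rsubmx _) => c G' {G}.
have [->|c_neq0] := eqVneq c 0.
  have [P IP GPG] := IHr G'; exists (col_mx (0 : 'M_(1, n)) P).
    by move=> i j; rewrite mul_row_col mul0mx add0r.
  by rewrite mul_row_col mul0mx add0r mul_mx_row mulmx0 GPG.
have [b Icb bc1] := ideal_invertible iota c_neq0.
(* Splitting off the first coordinate: left multiplication by [1%:M - c *m b] sends [row_mx c G'] to
   [row_mx 0 H], and induction applies to [H]. *)
pose H := G' - c *m (b *m G'); have [P IP HPH] := IHr H.
pose T := H *m P *m (1%:M - c *m b).
have bH : b *m H = 0 by rewrite /H mulmxBr !mulmxA bc1 mul1mx subrr.
have Ec : T *m c = 0.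
  rewrite /T -mulmxA.
  have -> : (1%:M - c *m b) *m c = 0; last by rewrite mulmx0.
  by rewrite mulmxBl mul1mx -mulmxA bc1 mulmx1 subrr.
have EH : T *m H = H.
  rewrite /T -mulmxA.
  have -> : (1%:M - c *m b) *m H = H; last exact: HPH.
  by rewrite mulmxBl mul1mx -mulmxA bH mulmx0 subr0.
pose R := P *m (1%:M - c *m b).
(* The projector is [T + c *m b]: [T] fixes [H] and kills [c], while [c *m b] fixes [c] and kills
   [H]. *)
have GR : row_mx c G' *m col_mx (b - b *m G' *m R) R = T + c *m b.
  rewrite mul_row_col mulmxBr -addrA addrC [- _ + _]addrC; congr (_ + _).
  by rewrite /T -[H *m P *m _]mulmxA -/R /H mulmxBl !mulmxA.
exists (col_mx (b - b *m G' *m R) R); rewrite GR.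
  move=> i j; rewrite mxE; apply: integersD => //.
  rewrite /T mulmxBr mulmx1 mxE; apply: integersD => //.
  rewrite !(mxE, big_ord1); apply: integersN.
  by apply: integers_sum => k _; apply: integersM.
rewrite mul_mx_row mulmxDl Ec add0r -mulmxA bc1 mulmx1; congr row_mx.
have {1}-> : G' = H + c *m (b *m G') by rewrite /H subrK.
rewrite mulmxDr [_ *m H]mulmxDl EH -mulmxA bH mulmx0 addr0.
rewrite mulmxA [_ *m c]mulmxDl Ec add0r -[c *m b *m c]mulmxA bc1 mulmx1.
by rewrite /H subrK.
Qed.

(** * Positivity and conjugates *)

Definition qform (R : comNzRingType) n (A : 'M[R]_n) (z : 'rV[R]_n) : R :=
  (z *m A *m z^T) 0 0.

Lemma qform_map (R S : comNzRingType) (f : {rmorphism R -> S}) n (A : 'M[R]_n)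
    (z : 'rV[R]_n) : f (qform A z) = qform (map_mx f A) (map_mx f z).
Proof. by rewrite /qform map_trmx -!map_mxM [RHS]mxE. Qed.

Lemma mulmx_trC (R : comNzRingType) n (u v : 'rV[R]_n) :
  u *m v^T = v *m u^T.
Proof.
by rewrite -[LHS]trmxK trmx_mul trmxK; apply/matrixP => i j; rewrite !ord1 !mxE.
Qed.

Lemma qform_block (R : comNzRingType) n (a : R) (b : 'rV[R]_n) (A : 'M[R]_n)
    (x : R) (v : 'rV[R]_n) :
  qform (block_mx a%:M b b^T A) (row_mx x%:M v)
  = a * x ^+ 2 + 2 * x * (v *m b^T) 0 0 + qform A v.
Proof.
rewrite /qform mul_row_block tr_row_mx mul_row_col !mulmxDl tr_scalar_mx.
have -> : v *m b^T *m x%:M = x *: (v *m b^T).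
  by rewrite -mul_scalar_mx scalar_mxC.
rewrite !mul_scalar_mx -!scalemxAl [b *m _]mulmx_trC.
rewrite !mxE !big_ord1 !mxE /= !mulr1n; ring.
Qed.

Lemma qform_schur (R : comNzRingType) n (b : 'rV[R]_n) (A : 'M[R]_n) (c : R)
    (v : 'rV[R]_n) :
  qform (A - c *: (b^T *m b)) v = qform A v - c * ((v *m b^T) 0 0) ^+ 2.
Proof.
rewrite /qform mulmxBr mulmxBl -scalemxAr -scalemxAl mxE; congr (_ + _).
rewrite 2!mxE; congr (- (_ * _)); rewrite mulmxA -[_ *m b *m _]mulmxA.
by rewrite [b *m _]mulmx_trC [LHS]mxE big_ord1.
Qed.

(* By Schur complements; no approximation of reals by elements of [K]. *)
Lemma qform_ge0_map (K : fieldType) (f : {rmorphism K -> algC}) n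
    (A : 'M[K]_n) : A^T = A -> (forall z, 0 <= f (qform A z)) ->
  forall u : 'rV[algC]_n, (forall i, u 0 i \is Num.real) ->
    0 <= qform (map_mx f A) u.
Proof.
elim: n A => [|n IHn] A Asym Apos u Ru.
  by rewrite /qform mxE big_ord0.
rewrite -[n.+1]/(1 + n)%N in A Asym Apos u Ru *.
move: Asym Apos; rewrite -[A]submxK.
set B := ulsubmx A; set b := ursubmx A.
set b' := dlsubmx A; set A' := drsubmx A.
clearbody B b b' A'; rewrite tr_block_mx => /eq_block_mx[_ b'E _ A'sym] Apos.
have {}b'E : b' = b^T by rewrite -b'E trmxK.
rewrite {}b'E [B]mx11_scalar in Apos *; move: (B 0 0) Apos => a Apos {B b'}.
pose x := u 0 (lshift n 0); pose v := rsubmx (u : 'rV_(1 + n)).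
have uE : u = row_mx x%:M v.
  rewrite -[u]hsubmxK; congr row_mx.
  by apply/matrixP => i j; rewrite !ord1 !mxE mulr1n.
have Rx : x \is Num.real by apply: Ru.
have Rv i : v 0 i \is Num.real by rewrite mxE; apply: Ru.
rewrite uE map_block_mx map_scalar_mx -map_trmx qform_block.
have Apos' t z : 0 <= f (a * t ^+ 2 + 2 * t * (z *m b^T) 0 0 + qform A' z).
  by rewrite -qform_block.
have Rfa : 0 <= f a.
  by have := Apos' 1 0; rewrite /qform !mul0mx !mxE mulr0 !addr0 expr1n mulr1.
have deltaE i : (delta_mx (0 : 'I_1) i *m b^T) 0 0 = b 0 i.
  rewrite mxE (bigD1 i) //= !mxE !eqxx mul1r big1 ?addr0 // => j /negPf ji.
  by rewrite !mxE ji andbF mul0r.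
have [a0|a_neq0] := eqVneq a 0.
  have b0 : b = 0.
    apply/rowP => i; rewrite mxE; apply/eqP; apply: contraT => bi_neq0.
    pose c := qform A' (delta_mx 0 i).
    (* With [a = 0] the form is affine in the first coordinate; this choice gives it the value
       -1. *)
    have := Apos' (- (c + 1) / (2 * b 0 i)) (delta_mx 0 i).
    have two_neq0 : 2 != 0 :> K by rewrite -(fmorph_eq0 f) rmorph_nat pnatr_eq0.
    rewrite a0 mul0r add0r deltaE -/c.
    have -> : 2 * (- (c + 1) / (2 * b 0 i)) * b 0 i + c = - 1.
      by field; rewrite bi_neq0 two_neq0.
    by rewrite rmorphN1 oppr_ge0 ler10.
  rewrite a0 b0 rmorph0 map_mx0 trmx0 mulmx0 mxE mul0r mulr0 !add0r.
  apply: IHn => // z; have := Apos' 0 z.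
  by rewrite expr0n !mulr0 mul0r !add0r.
have fa_neq0 : f a != 0 by rewrite fmorph_eq0.
pose S := A' - a^-1 *: (b^T *m b).
set w := (v *m _) 0 0.
(* Completing the square leaves the form of the Schur complement [S]. *)
have -> : f a * x ^+ 2 + 2 * x * w + qform (map_mx f A') v
          = f a * (x + w / f a) ^+ 2 + qform (map_mx f S) v.
  have -> : map_mx f S
      = map_mx f A' - (f a)^-1 *: ((map_mx f b)^T *m map_mx f b).
    by rewrite map_mxB map_mxZ map_mxM map_trmx fmorphV.
  rewrite qform_schur -/w; field; exact: fa_neq0.
(* Polarisation expresses each entry through three values of the form, which are real because they
   are nonnegative. *)
have fb i : f (b 0 i) \is Num.real.
  have /ger0_real := Apos' 1 (delta_mx 0 i).
  have /ger0_real := Apos' 0 (delta_mx 0 i).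
  rewrite !deltaE expr0n !mulr0 mul0r !add0r expr1n !mulr1.
  set q := qform _ _ => Rq Rs.
  have -> : f (b 0 i) = (f (a + 2 * b 0 i + q) - f a - f q) / 2.
    by rewrite !rmorphD rmorphM rmorph_nat; field.
  by rewrite rpred_div ?rpred_nat // !rpredB // ger0_real.
have Rw : w \is Num.real.
  rewrite /w mxE; apply: rpred_sum => i _; apply: rpredM => //.
  by rewrite !mxE.
apply: addr_ge0.
  apply: mulr_ge0 => //; rewrite -realEsqr.
  by apply: rpredD => //; apply: rpred_div => //; apply: ger0_real.
apply: IHn => //.
  by rewrite /S linearB linearZ /= trmx_mul trmxK A'sym.
(* This first coordinate makes the completed square vanish, so the value is that of [S] at [z]. *)
move=> z; have := Apos' (- (z *m b^T) 0 0 / a) z; rewrite qform_schur.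
set t := (z *m _) 0 0; congr (0 <= f _); field; exact: a_neq0.
Qed.

(** The roots of the minimal polynomial generate a normal number field; sending [x] to [y] extends
    to that field and then to [algC]. A bound valid under all embeddings thus bounds all
    conjugates. *)
Lemma algC_conjugate (x y : algC) : root (minCpoly x) y ->
  exists nu : {rmorphism algC -> algC}, nu x = y.
Proof.
move=> xy; have [r Dr] := closed_field_poly_normal (minCpoly x).
move: Dr; rewrite (monicP (minCpoly_monic x)) scale1r => Dr.
have [Qr [QrC [r1 Dr1 genQr]]] := num_field_exists r.
have root_r z : root (minCpoly x) z -> exists2 z1, z1 \in r1 & QrC z1 = z.
  by rewrite Dr root_prod_XsubC -Dr1 => /mapP[z1 z1r ->]; exists z1.
have [x1 _ Dx] := root_r x (root_minCpoly x); have [y1 _ Dy] := root_r y xy.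
have ratQ (q : {poly rat}) :
    map_poly QrC (map_poly (in_alg Qr) q) = map_poly ratr q.
  rewrite -map_poly_comp; apply: eq_map_poly => a /=.
  by rewrite alg_num_field fmorph_rat.
have [q [Dq _] dvq] := minCpolyP x.
pose pr := map_poly (in_alg Qr) q.
have Qpr : pr \is a polyOver 1%VS by apply: alg_polyOver.
have split_pr : splittingFieldFor <<1; x1>> pr fullv.
  apply: (splittingFieldForS (sub1v _) (subvf _)); exists r1 => //.
  suff -> : pr = \prod_(z <- r1) ('X - z%:P) by apply: eqpxx.
  apply: (map_poly_inj QrC); rewrite ratQ -Dq Dr -Dr1 big_map rmorph_prod /=.
  by apply: eq_bigr => z _; rewrite map_polyXsubC.
have xy1 : root (map_poly \1%VF (minPoly 1 x1)) y1.
  rewrite map_polyE map_id_in => [|?]; last by rewrite id_lfunE.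
  rewrite polyseqK.
  have /polyOver1P[q1 Dq1] := minPolyOver 1 x1.
  have : root (minPoly 1 x1) x1 by apply: root_minPoly.
  rewrite Dq1 -!(fmorph_root QrC) ratQ Dx Dy dvq => /dvdpP[q2 ->].
  by rewrite rmorphM rootM /= -Dq xy orbT.
have hom_f := kHomExtendP (sub1v 1%AS) (kHom1 1 1) xy1.
have [f1 hom_f1 Df1] := kHom_extends (sub1v _) hom_f Qpr split_pr.
pose f1M := GRing.isMonoidMorphism.Build _ _ f1 (kHom_monoid_morphism hom_f1).
pose f1RM : {rmorphism _ -> _} := HB.pack (fun_of_lfun f1) f1M.
have [nu Dnu] := extend_algC_subfield_aut QrC f1RM.
exists nu; rewrite -Dx -Dnu -Dy /=; congr (QrC _).
by rewrite -Df1 ?memv_adjoin // (kHomExtend_val (kHom1 1 1) xy1).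
Qed.

(** Every embedding sends [x] to one of the finitely many roots of its rational minimal
    polynomial. *)
Lemma num_field_conj_bound (K : fieldExtType rat) (x : K) :
  exists B : nat, forall s : {rmorphism K -> algC}, `|s x| <= B%:R.
Proof.
have /polyOver1P[q Dq] := minPolyOver 1 x.
have q_neq0 : map_poly (ratr : rat -> algC) q != 0.
  rewrite map_poly_eq0; apply: contraTneq (monic_minPoly 1 x) => q0.
  by rewrite Dq q0 rmorph0 monicE lead_coef0 eq_sym oner_eq0.
have [r Dr] := closed_field_poly_normal (map_poly (ratr : rat -> algC) q).
have S_ge0 : 0 <= \sum_(z <- r) `|z| by apply: sumr_ge0.
exists (Num.bound (\sum_(z <- r) `|z|)) => s.
apply: le_trans (ltW (archi_boundP S_ge0)).
have : root (map_poly ratr q) (s x).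
  have := root_minPoly 1 x; rewrite Dq -(fmorph_root s) -map_poly_comp.
  congr (root _ _); apply: eq_map_poly => a /=.
  by rewrite alg_num_field fmorph_rat.
rewrite Dr rootZ ?lead_coef_eq0 // root_prod_XsubC => sxr.
by rewrite (big_rem _ sxr) /= lerDl sumr_ge0.
Qed.

(** Each factor X - z multiplies a bound on the coefficients by at most 1 + B. *)
Lemma coef_prod_XsubC_bound (R : numDomainType) (B : R) (s : seq R) i :
    0 <= B -> (forall z, z \in s -> `|z| <= B) ->
  `|(\prod_(z <- s) ('X - z%:P))`_i| <= (1 + B) ^+ size s.
Proof.
move=> B0; elim: s i => [|z s IHs] i sB.
  by rewrite big_nil coef1; case: eqP => _; rewrite ?normr1 ?normr0 ?ler01.
have {}IHs j := IHs j (fun z' zs => sB z' (mem_behead (s := z :: s) zs)).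
have X0 : 0 <= (1 + B) ^+ size s by rewrite exprn_ge0 // addr_ge0.
rewrite big_cons mulrBl coefB coefXM coefCM exprS mulrDl mul1r.
apply: le_trans (ler_normB _ _) _; apply: lerD.
  by case: eqP => _; rewrite ?normr0.
by rewrite normrM; apply: ler_pM => //; apply: sB; rewrite mem_head.
Qed.

(** Northcott's argument: bounded conjugates bound the integer coefficients of the minimal
    polynomial, so finitely many polynomials occur. *)
Lemma finite_algebraic_integers (m B : nat) : exists s : seq algC,
  forall x, x \in Aint -> (size (minCpoly x) <= m.+1)%N ->
    (forall y, root (minCpoly x) y -> `|y| <= B%:R) -> x \in s.
Proof.
pose C := ((1 + B) ^ m)%N.
(* A coefficient in [-C, C] is stored as an ordinal below 2C + 1, shifted by [C]. *)
pose p (f : {ffun 'I_m.+1 -> 'I_(2 * C).+1}) : {poly algC} :=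
  \poly_(i < m.+1) (((f (inord i))%:Z - C%:Z)%:~R).
pose rts f := sval (closed_field_poly_normal (p f)).
exists (flatten [seq rts f | f <- enum {ffun 'I_m.+1 -> 'I_(2 * C).+1}]).
move=> x xint szx xB; have [r Dr] := closed_field_poly_normal (minCpoly x).
move: Dr; rewrite (monicP (minCpoly_monic x)) scale1r => Dr.
have coefB i : `|(minCpoly x)`_i| <= C%:R.
  rewrite /C natrX natrD [in leLHS]Dr.
  have rB z : z \in r -> `|z| <= B%:R by rewrite -root_prod_XsubC -Dr => /xB.
  apply: le_trans (coef_prod_XsubC_bound i (ler0n _ B) rB) _.
  rewrite ler_weXn2l ?lerDl ?ler0n //.
  by rewrite -ltnS (leq_trans _ szx) // Dr size_prod_XsubC.
have /all_sig[c Dc] : forall i, {z : int | (minCpoly x)`_i = z%:~R}.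
  by move=> i; apply: sig_eqW; apply/intrP; apply: (polyOverP xint).
have cB i : (`|c i| <= C%:Z).
  by have := coefB i; rewrite Dc -intr_norm pmulrn ler_int.
have fB i : (absz (c i + C%:Z)%R < (2 * C).+1)%N.
  have := cB i; lia.
pose f := [ffun i : 'I_m.+1 => Ordinal (fB i)].
have pE : minCpoly x = p f.
  apply/polyP => i; rewrite coef_poly; case: ltnP => [lti|lei]; last first.
    by apply: nth_default; apply: leq_trans lei.
  rewrite Dc ffunE /=; congr (_%:~R); rewrite inordK //.
  have := cB i; lia.
apply/flattenP; exists (rts f); first by apply: map_f; rewrite mem_enum.
rewrite /rts; case: closed_field_poly_normal => r' /= Dr'.
have := root_minCpoly x; rewrite pE Dr' rootZ ?root_prod_XsubC //.
by rewrite lead_coef_eq0 -pE minCpoly_eq0.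
Qed.

(** * The Gram matrix of a lattice *)

(** The rational minimal polynomial has an integer multiple, whose leading coefficient times [x] is
    integral. *)
Lemma num_field_denominator (K : fieldExtType rat) (x : K) :
  exists2 N : nat, (0 < N)%N & integers (N%:R * x).
Proof.
have /polyOver1P[q Dq] := minPolyOver 1 x.
have [h [a a_neq0 Dqh]] := rat_poly_scale q.
have h_neq0 : h != 0.
  apply: contraTneq (monic_minPoly 1 x) => h0.
  rewrite Dq Dqh h0 !rmorph0 scaler0 rmorph0.
  by rewrite monicE lead_coef0 eq_sym oner_eq0.
have intr_inj : injective (intr : int -> K).
  move=> y z /eqP; rewrite -subr_eq0 -rmorphB /= -(rmorph_int (in_alg K)) /=.
  by rewrite scaler_eq0 oner_eq0 orbF intr_eq0 subr_eq0 => /eqP.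
have : root (map_poly (intr : int -> K) h) x.
  have := root_minPoly 1 x; rewrite Dq Dqh map_polyZ /= rootZ.
    rewrite -map_poly_comp; congr (root _ _); apply: eq_map_poly => z /=.
    by rewrite -[LHS]/(in_alg K _) rmorph_int.
  by rewrite scaler_eq0 oner_eq0 orbF invr_eq0 intr_eq0.
move/integers_lead_coef_root; rewrite lead_coef_map_inj //.
set l := lead_coef h => Hl.
have {}Hl : integers (l%:~R * x : K).
  by apply: Hl => i; rewrite coef_map; apply: integers_int.
exists `|l|%N; first by rewrite absz_gt0 lead_coef_eq0.
rewrite pmulrn; case: (ger0P l) (abszE l) => _ -> //.
by rewrite rmorphN mulNr; apply: integersN.
Qed.

Lemma num_field_denominators (K : fieldExtType rat) n (z : 'rV[K]_n) :
  exists2 N : nat, (0 < N)%N & forall i, integers (N%:R * z 0 i).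
Proof.
have /fin_all_exists2[N N_gt0 NP] i := num_field_denominator (z 0 i).
exists (\prod_i N i)%N => [|i]; first by apply: prodn_gt0.
rewrite (bigD1 i) //= mulnC natrM -mulrA; apply: integersM => //.
exact: integral_nat.
Qed.

Lemma qformD (R : comNzRingType) n (A : 'M[R]_n) (u v : 'rV[R]_n) :
  A^T = A ->
  qform A (u + v) = qform A u + qform A v + 2 * (u *m A *m v^T) 0 0.
Proof.
move=> Asym; rewrite /qform linearD /= mulmxDr !mulmxDl.
have -> : v *m A *m u^T = u *m A *m v^T.
  have <- : (v *m A *m u^T)^T = u *m A *m v^T.
    by rewrite !trmx_mul trmxK Asym mulmxA.
  by apply/matrixP => i j; rewrite !ord1 [RHS]mxE.
by rewrite !mxE; ring.
Qed.

Lemma qformZ (R : comNzRingType) n (A : 'M[R]_n) (c : R) (u : 'rV[R]_n) :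
  qform A (c *: u) = c ^+ 2 * qform A u.
Proof.
by rewrite /qform linearZ /= -scalemxAr -!scalemxAl scalerA mxE expr2.
Qed.

Section Gram.

Import VectorInternalTheory.

Context (K : fieldExtType rat) (V : vectType K) (Lam : set V) (Q : V -> K).
Context (n : nat) (g : 'I_n -> V).
Hypothesis LamQ : quadratic_lattice Lam Q.
Hypothesis LamE : forall v, Lam v <-> exists c : 'I_n -> K,
  (forall i, integers (c i)) /\ v = \sum_(i < n) c i *: g i.

(** The diagonal is 2 Q(g_i), so the associated form is twice [Q]. The generators may be dependent,
    and then the matrix is singular. *)
Definition gram : 'M[K]_n := \matrix_(i, j) polar Q (g i) (g j).

Lemma gram_sym : gram^T = gram.
Proof. by apply/matrixP => i j; rewrite !mxE polarC. Qed.

Lemma lattice_comb (c : 'I_n -> K) :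
  (forall i, integers (c i)) -> Lam (\sum_i c i *: g i).
Proof. by move=> Ic; apply/LamE; exists c. Qed.

Lemma lattice_generator i : Lam (g i).
Proof.
have -> : g i = \sum_j (i == j)%:R *: g j.
  rewrite (bigD1 i) //= eqxx scale1r big1 ?addr0 // => j.
  by rewrite eq_sym => /negPf->; rewrite scale0r.
by apply: lattice_comb => j; apply: integral_nat.
Qed.

Lemma lattice0 : Lam 0.
Proof. by have [] := fin_gen_submodule_closed (ql_fin_gen LamQ). Qed.

Lemma polar0l w : Lam w -> polar Q 0 w = 0.
Proof.
move=> Lw; have := ql_bilinearl LamQ (integers1 K) lattice0 lattice0 Lw.
by rewrite scale1r addr0 mul1r => /eqP; rewrite -subr_eq subrr => /eqP.
Qed.

Lemma polar_comb (c : 'I_n -> K) w : (forall i, integers (c i)) -> Lam w ->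
  polar Q (\sum_i c i *: g i) w = \sum_i c i * polar Q (g i) w.
Proof.
move=> Ic Lw; pose P (v : V) x := Lam v /\ polar Q v w = x.
suff [] : P (\sum_i c i *: g i) (\sum_i c i * polar Q (g i) w) by [].
apply: (big_rec2 P) => [|i x v _ [Lv <-]].
  by split; [apply: lattice0 | apply: polar0l].
have Lg := lattice_generator i; split; last exact: (ql_bilinearl LamQ).
by have [_] := fin_gen_submodule_closed (ql_fin_gen LamQ); apply.
Qed.

Lemma polar_diag v : Lam v -> polar Q v v = 2 * Q v.
Proof.
move=> Lv; rewrite /polar -mulr2n -scaler_nat (ql_scale LamQ) //.
  by ring.
exact: integral_nat.
Qed.

Lemma qform_gram (z : 'rV[K]_n) : (forall i, integers (z 0 i)) ->
  qform gram z = 2 * Q (\sum_i z 0 i *: g i).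
Proof.
move=> Iz; have Lz := lattice_comb Iz.
rewrite -polar_diag // polar_comb // /qform -mulmxA mxE.
apply: eq_bigr => i _.
rewrite polarC polar_comb //; last exact: lattice_generator.
by congr (_ * _); rewrite mxE; apply: eq_bigr => j _; rewrite !mxE polarC mulrC.
Qed.

(** A common denominator moves [z] into the integral vectors, where the form is twice a value of
    [Q]. Only a weak inequality holds, since a nonzero [z] may be a relation between the
    generators. *)
Lemma qform_gram_ge0 : positive_definite Lam Q ->
  forall (s : {rmorphism K -> algC}) (z : 'rV[K]_n), 0 <= s (qform gram z).
Proof.
move=> Qpos s z; have [N N_gt0 IN] := num_field_denominators z.
have N_neq0 : (N%:R : algC) ^+ 2 != 0 by rewrite expf_neq0 // pnatr_eq0 -lt0n.
suff : 0 <= s (qform gram (N%:R *: z)).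
  rewrite qformZ rmorphM rmorphXn rmorph_nat pmulr_rge0 //.
  by rewrite exprn_gt0 // ltr0n.
have INz i : integers ((N%:R *: z) 0 i) by rewrite mxE.
rewrite qform_gram // rmorphM rmorph_nat mulr_ge0 ?ler0n //.
set v := \sum_i _; have Lv : Lam v by apply: lattice_comb.
have [->|v_neq0] := eqVneq v 0; last by rewrite ltW // Qpos.
have := ql_scale LamQ (integers0 K) lattice0.
by rewrite scale0r expr0n mul0r => ->; rewrite rmorph0.
Qed.

(** A multiple of the combination lies in the lattice and has [Q] equal to 0, which positivity at
    the given embedding allows only for the zero vector. *)
Lemma gram_kernel : positive_definite Lam Q -> {rmorphism K -> algC} ->
  forall z : 'rV[K]_n, z *m gram = 0 -> \sum_i z 0 i *: g i = 0.
Proof.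
move=> Qpos s z zA; have [N N_gt0 IN] := num_field_denominators z.
have INz i : integers ((N%:R *: z) 0 i) by rewrite mxE.
have N_neq0 : N%:R != 0 :> K.
  by rewrite -(fmorph_eq0 s) rmorph_nat pnatr_eq0 -lt0n.
have two_neq0 : 2 != 0 :> K by rewrite -(fmorph_eq0 s) rmorph_nat pnatr_eq0.
set v := \sum_i _.
have vE : \sum_i (N%:R *: z) 0 i *: g i = N%:R *: v.
  by rewrite scaler_sumr; apply: eq_bigr => i _; rewrite mxE scalerA.
have Lv : Lam (N%:R *: v) by rewrite -vE; apply: lattice_comb.
have := qform_gram INz; rewrite vE /qform -scalemxAl zA scaler0 mul0mx mxE.
move/esym/eqP; rewrite mulf_eq0 (negPf two_neq0) /= => /eqP Qv0.
apply/eqP; apply: contraT => v_neq0.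
have Nv_neq0 : N%:R *: v != 0 by rewrite scaler_eq0 negb_or N_neq0.
by have := Qpos _ Lv Nv_neq0 s; rewrite Qv0 rmorph0 ltxx.
Qed.

(** [T] fixes the generators, hence preserves their pairings. A row vector killed by [gram] is a
    relation, hence killed by [T]; so the columns of [T] lie in the column space of [gram], and [N]
    records the coefficients. *)
Lemma gram_projector : positive_definite Lam Q -> {rmorphism K -> algC} ->
  exists T N : 'M[K]_n,
    [/\ forall i j, integers (T i j), T *m gram = gram & T = gram *m N].
Proof.
move=> Qpos s; pose G := \matrix_i v2r (g i).
have [P IT TG] := integers_projector s G; set T := G *m P in IT TG.
have combG (z : 'rV[K]_n) : z *m G = v2r (\sum_i z 0 i *: g i).
  rewrite mulmx_sum_row linear_sum; apply: eq_bigr => i _.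
  by rewrite linearZ /= rowK.
have TgE i : \sum_k T i k *: g k = g i.
  have -> : \sum_k T i k *: g k = \sum_k row i T 0 k *: g k.
    by apply: eq_bigr => k _; rewrite [row _ _ _ _]mxE.
  by apply: (can_inj v2rK); rewrite -combG -row_mul TG rowK.
exists T.
have TA : T *m gram = gram.
  apply/matrixP => i j; rewrite !mxE -[in RHS]TgE polar_comb //.
    by apply: eq_bigr => k _; rewrite [gram _ _]mxE.
  exact: lattice_generator.
suff /submxP[D DT] : (T^T <= gram)%MS.
  exists D^T; split=> //.
  by rewrite -[LHS]trmxK DT trmx_mul gram_sym.
rewrite submxE; set C := cokermx gram.
have AC : C^T *m gram = 0.
  by rewrite -[gram]gram_sym -trmx_mul mulmx_coker trmx0.
rewrite -[T^T *m C]trmxK trmx_mul trmxK; apply/eqP.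
suff -> : C^T *m T = 0 by rewrite trmx0.
rewrite /T mulmxA; suff -> : C^T *m G = 0 by rewrite mul0mx.
apply/row_matrixP => i; rewrite row_mul row0 combG gram_kernel ?linear0 //.
by rewrite -row_mul AC row0.
Qed.

(** * Values over an overring in terms of the Gram matrix *)

Context (L : fieldExtType K) (S : set L).
Hypothesis Sring : overring S.

Let SA a : integers a -> S a%:A. Proof. by case: Sring => H _ _; apply: H. Qed.
Let SB x y : S x -> S y -> S (x - y).
Proof. by case: Sring => _ H _; apply: H. Qed.
Let SM x y : S x -> S y -> S (x * y). Proof. by case: Sring => _ _; apply. Qed.
Let S0 : S 0. Proof. by rewrite -(scale0r 1); apply/SA/integers0. Qed.
Let SD x y : S x -> S y -> S (x + y).
Proof. by move=> Sx Sy; rewrite -[y]opprK -[- y]sub0r; do 2?apply: SB. Qed.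

Definition gen_tensor (u : 'rV[L]_n) : seq (V * L) :=
  [seq (g i, u 0 i) | i <- enum 'I_n].

Lemma gen_tensorP (u : 'rV[L]_n) :
  (forall i, S (u 0 i)) -> tensor Lam S (gen_tensor u).
Proof.
by move=> Su p /mapP[i _ ->]; split=> //=; apply: lattice_generator.
Qed.

Lemma tensor_cross_gen (u w : 'rV[L]_n) :
  tensor_cross Q (gen_tensor u) (gen_tensor w)
  = (u *m map_mx (in_alg L) gram *m w^T) 0 0.
Proof.
rewrite /tensor_cross big_map big_enum /= -mulmxA mxE; apply: eq_bigr => i _.
rewrite big_map big_enum /= mxE mulr_sumr; apply: eq_bigr => j _.
by rewrite !mxE /= -mulrA [w 0 j * _]mulrC.
Qed.

Lemma tensor_cross_diag x : tensor Lam S x ->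
  tensor_cross Q x x = 2 * tensor_form Q x.
Proof.
elim: x => [|[v s] x IHx]; first by rewrite /tensor_cross big_nil mulr0.
rewrite -cat1s => /tensor_catE[/tensor_seq1E[Lv Ss] /IHx xx].
rewrite tensor_form_cat !tensor_cross_cat !(tensor_crossC Q _ (_ ++ _)).
rewrite !tensor_cross_cat xx (tensor_crossC Q x).
rewrite {1}/tensor_cross !big_seq1 /= big_nil polar_diag //.
by rewrite mulr_natl -scalerMnl; ring.
Qed.

(** Expanding each lattice vector on the generators moves its coefficients into the second factor.
    Agreement of all pairings is enough to recover the value of the form, as half the pairing of a
    tensor with itself. *)
Lemma tensor_gen x : tensor Lam S x -> exists2 u : 'rV[L]_n,
  forall i, S (u 0 i) &
  forall y, tensor Lam S y ->
    tensor_cross Q x y = tensor_cross Q (gen_tensor u) y.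
Proof.
have crossE u y : tensor_cross Q (gen_tensor u) y =
    \sum_i u 0 i * \sum_(r <- y) r.2 * (polar Q (g i) r.1)%:A.
  rewrite /tensor_cross big_map big_enum; apply: eq_bigr => i _.
  by rewrite mulr_sumr; apply: eq_bigr => r _; rewrite mulrA.
elim: x => [|[v s] x IHx] xT.
  exists 0 => [i|y _]; first by rewrite mxE.
  by rewrite crossE /tensor_cross big_nil big1 // => i _; rewrite mxE mul0r.
move: xT; rewrite -cat1s => /tensor_catE[/tensor_seq1E[Lv Ss] /IHx[u Su Hu]].
have [c [Ic vE]] := (LamE v).1 Lv.
exists (\row_i (s * (c i)%:A) + u) => [i|y Hy].
  by rewrite !mxE; apply: SD; [apply/SM/SA | apply: Su].
rewrite tensor_cross_cat Hu // !crossE.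
under [RHS]eq_bigr do rewrite !mxE mulrDl.
rewrite [RHS]big_split /=; congr (_ + _).
rewrite /tensor_cross big_seq1 /=.
under [RHS]eq_bigr do rewrite mulr_sumr.
rewrite exchange_big /=; apply: eq_big_seq => r /Hy[Lr _].
rewrite vE polar_comb // -[_%:A]/(in_alg L _) rmorph_sum mulr_sumr.
apply: eq_bigr => i _ /=; rewrite -[(_ * _)%:A]/(in_alg L _) rmorphM /=.
by ring.
Qed.

(** Turns representability into a matrix equation over [S]; the factor 2 comes from the Gram matrix
    and cancels in characteristic zero. *)
Lemma quadratic_values_gram (b : L) : quadratic_values Lam Q S b <->
  exists2 u : 'rV[L]_n, forall i, S (u 0 i) &
    qform (map_mx (in_alg L) gram) u = 2 * b.
Proof.
rewrite quadratic_valuesE //; split=> [[x Hx <-]|[u Su Hu]].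
  have [u Su xu] := tensor_gen Hx; exists u => //.
  rewrite -tensor_cross_diag // xu // tensor_crossC xu ?tensor_cross_gen //.
  exact: gen_tensorP.
exists (gen_tensor u); first exact: gen_tensorP.
have two_neq0 : 2 != 0 :> L.
  rewrite -(rmorph_nat (in_alg L)) fmorph_eq0 -(rmorph_nat (in_alg K)).
  by rewrite fmorph_eq0 pnatr_eq0.
apply: (mulfI two_neq0); rewrite -tensor_cross_diag; last exact: gen_tensorP.
by rewrite tensor_cross_gen.
Qed.

End Gram.

(** * Fields generated by bounded algebraic integers *)

Lemma size_minCpoly_le_dim (F : fieldExtType rat) (j : {rmorphism F -> algC})
    (x : F) : (size (minCpoly (j x)) <= (\dim {:F}).+1)%N.
Proof.
have /polyOver1P[q Dq] := minPolyOver 1 x.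
have [p [-> _] dvp] := minCpolyP (j x).
have pq : p %| q.
  rewrite -dvp; have := root_minPoly 1 x; rewrite Dq -(fmorph_root j).
  rewrite -map_poly_comp; congr (root _ _); apply: eq_map_poly => a /=.
  by rewrite alg_num_field fmorph_rat.
have q_neq0 : q != 0.
  apply: contraTneq (monic_minPoly 1 x) => q0.
  by rewrite Dq q0 rmorph0 monicE lead_coef0 eq_sym oner_eq0.
rewrite size_map_poly (leq_trans (dvdp_leq q_neq0 pq)) //.
rewrite -(size_map_poly (in_alg F)) -Dq size_minPoly ltnS adjoin_degreeE dimv1.
by rewrite divn1 dimvS ?subvf.
Qed.

Lemma Aint_integers (F : fieldType) (j : {rmorphism F -> algC}) (x : F) :
  integers x -> j x \in Aint.
Proof.
move/(integers_fmorph j) => [p mon_p px0].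
apply: (root_monic_Aint px0); first exact: monic_map.
by apply/polyOverP => i; rewrite coef_map intr_int.
Qed.

(** A set determined by [t], so finitely many [t] give finitely many sets. For an embedding [iota],
    opposites come from the image of -1, and for algebraic [t i] the generated ring is a field. *)
Definition subring_generated (K : fieldType) (iota : K -> algC) n
    (t : 'I_n -> algC) : set algC :=
  [set z | forall R : set algC,
    (forall x, R (iota x)) -> (forall i, R (t i)) ->
    (forall x y, R x -> R y -> R (x + y)) ->
    (forall x y, R x -> R y -> R (x * y)) -> R z].

(** The image of [j] is itself closed under the operations. Conversely, adjoining the generators one
    at a time, each new element is a polynomial in the last generator. *)
Lemma range_generated (K : fieldExtType rat) (iota : {rmorphism K -> algC})
    (L : fieldExtType K) (j : {rmorphism L -> algC}) n (s : 'I_n -> L) :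
    (forall x : K, j x%:A = iota x) ->
    <<1 & [seq s i | i <- enum 'I_n]>>%VS = {:L}%VS ->
  range j = subring_generated iota (fun i => j (s i)).
Proof.
move=> jA genL; apply/seteqP; split=> [_ [x _ <-] R RK Rs RD RM|z]; last first.
  apply.
  - by move=> x; exists x%:A.
  - by move=> i; exists (s i).
  - by move=> _ _ [x _ <-] [y _ <-]; exists (x + y); rewrite ?rmorphD.
  - by move=> _ _ [x _ <-] [y _ <-]; exists (x * y); rewrite ?rmorphM.
have R0 : R 0 by rewrite -(rmorph0 iota).
have adjR r (U : {subfield L}) : (forall y, y \in U -> R (j y)) ->
    (forall y, y \in r -> R (j y)) -> forall y, y \in <<U & r>>%VS -> R (j y).
  elim: r U => [|y r IHr] U RU Rr w.
    by rewrite adjoin_nil subfield_closed => /RU.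
  rewrite adjoin_cons; apply: (IHr <<U; y>>%AS) => [|z zr]; last first.
    by apply: Rr; rewrite inE zr orbT.
  move=> _ /Fadjoin_polyP[p Up ->].
  rewrite horner_coef rmorph_sum; elim/big_ind: _ => // i _.
  rewrite rmorphM; apply: (RM); first exact: (RU _ (polyOverP Up i)).
  have Ry : R (j y) by apply: Rr; rewrite mem_head.
  elim: (nat_of_ord i) => [|k IHk].
    by rewrite expr0 rmorph1 -(rmorph1 iota).
  by rewrite exprS rmorphM; apply: RM.
apply: (adjR [seq s i | i <- enum 'I_n] 1%AS _ _ x); last by rewrite genL memvf.
  by move=> _ /vlineP[k ->]; rewrite jA.
by move=> _ /mapP[i _ ->].
Qed.

(* From nonnegativity at [u + v] and [u - v]. *)
Lemma qform_polar_bound (K : fieldExtType rat) (L : fieldExtType K) n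
    (A : 'M[K]_n) (u v : 'rV[L]_n) (s : {rmorphism L -> algC}) :
    A^T = A -> totally_real L ->
    (forall (t : {rmorphism K -> algC}) (z : 'rV[K]_n), 0 <= t (qform A z)) ->
  `|s (2 * (u *m map_mx (in_alg L) A *m v^T) 0 0)|
  <= s (qform (map_mx (in_alg L) A) u) + s (qform (map_mx (in_alg L) A) v).
Proof.
move=> Asym Lreal Apos; set AL := map_mx _ A.
have ALsym : AL^T = AL by rewrite map_trmx Asym.
have pos w : 0 <= s (qform AL w).
  rewrite qform_map /AL -map_mx_comp.
  apply: (@qform_ge0_map _ (s \o in_alg L)) => // i.
  by rewrite mxE; apply: Lreal.
rewrite real_ler_norml ?Lreal //; apply/andP; split.
  have := pos (u + v); rewrite qformD // !rmorphD.
  by move=> uv_ge0; rewrite -subr_ge0 opprK addrC.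
have := pos (u + (-1) *: v); rewrite qformD // qformZ sqrrN expr1n mul1r.
rewrite linearZ /= -scalemxAr mxE mulN1r mulrN rmorphB rmorphD.
by rewrite subr_ge0.
Qed.

(** Extensions are counted through their images in [algC] over the fixed embedding [iota]; every
    finite extension of [K] has such an image, which determines it up to isomorphism over [K]. *)
Theorem theorem3p1 (d : nat) (K : fieldExtType rat)
    (iota : {rmorphism K -> algC}) (V : vectType K)
    (Lam : set V) (Q : V -> K) (a : K)
    (d_gt0 : (0 < d)%N)
    (K_real : totally_real K)
    (LamQ : quadratic_lattice Lam Q)
    (Q_pos : positive_definite Lam Q)
    (a_int : integers a) :
  finite_set [set M : set algC |
    exists (L : fieldExtType K) (j : {rmorphism L -> algC}),
      [/\ (forall x : K, j x%:A = iota x) /\ M = range j,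
          totally_real L,
          \dim {:L} = d,
          quadratic_values Lam Q (integers_in {:L}) a%:A
        & forall E : {subfield L}, E != {:L}%AS ->
            ~ quadratic_values Lam Q (integers_in E) a%:A]].
Proof.
have [n [g LamE]] := ql_fin_gen LamQ.
have Asym := gram_sym Q g; have Apos := qform_gram_ge0 LamQ LamE Q_pos.
have [T [N [IT TA TN]]] := gram_projector LamQ LamE Q_pos iota.
have valuesE := quadratic_values_gram LamQ LamE.
set A := gram Q g in Asym Apos TA TN valuesE.
(* These are the fixed vectors over [K] whose pairings with the tensor give the entries of [s]. *)
pose nu i := (col i N)^T; pose q i := qform A (nu i).
have [Ba BaP] := num_field_conj_bound a.
have /fin_all_exists[Bq BqP] i := num_field_conj_bound (q i).
(* The polar bound gives 2 |t(s_i)| <= 2 t(a) + t(q_i); the sum serves all [i] at once. *)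
pose B := (Ba + \sum_i Bq i)%N.
(* The degree of L over the rationals is d [K : Q]. *)
have [r rP] := finite_algebraic_integers (d * \dim {:K}) B.
pose gen (f : {ffun 'I_n -> 'I_(size r)}) :=
  subring_generated iota (fun i => r`_(f i)).
apply: (@sub_finite_set _ _ (gen @` setT)); last first.
  exact/finite_image/finite_finset.
move=> M [L [j [[jA ->] Lreal dimL aL minL]]].
have [u Iu uA] := (valuesE _ _ (integers_in_overring _) _).1 aL.
pose AL := map_mx (in_alg L) A; pose TL := map_mx (in_alg L) T.
pose s := u *m TL.
have TLA : TL *m AL = AL by rewrite -map_mxM TA.
have ALsym : AL^T = AL by rewrite map_trmx Asym.
(* The form is unchanged because T A = A, and A T^T = A by symmetry. *)
have sA : qform AL s = 2 * a%:A.
  rewrite -uA /qform /s trmx_mul -!mulmxA; congr ((_ *m _) 0 0).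
  rewrite [TL *m (AL *m _)]mulmxA TLA mulmxA -{1}ALsym -trmx_mul TLA.
  by rewrite ALsym.
have Is i : integers (s 0 i).
  rewrite mxE; apply: integers_sum => k _; apply: integersM.
    by case: (Iu k).
  rewrite mxE; case: (integers_in_overring {:L}%AS) => IA _ _.
  by case: (IA _ (IT k i)).
pose sr := [seq s 0 i | i <- enum 'I_n].
have genL : <<1 & sr>>%VS = {:L}%VS.
  have [/(congr1 val)//|neqE] := eqVneq <<1 & sr>>%AS {:L}%AS.
  (* The entries of [s] are integers of the subfield they generate, so [a] is already represented
     there. *)
  case: (minL _ neqE); apply/valuesE; first exact: integers_in_overring.
  exists s => // i; split=> //.
  by apply: seqv_sub_adjoin; apply: map_f; rewrite mem_enum.
have sB (t : {rmorphism L -> algC}) i : `|t (s 0 i)| <= B%:R.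
  pose tK : {rmorphism K -> algC} := t \o in_alg L.
  pose nuL := map_mx (in_alg L) (nu i).
  (* From T = A N, entry i of u T is the pairing of [u] with [nu i]. *)
  have sE : s 0 i = (u *m AL *m nuL^T) 0 0.
    rewrite /s /TL TN map_mxM mulmxA /nuL map_trmx trmxK.
    rewrite [LHS]mxE [RHS]mxE; apply: eq_bigr => k _.
    by congr (_ * _); rewrite !mxE.
  have := qform_polar_bound u nuL t Asym Lreal Apos.
  rewrite -/AL -sE uA -[qform AL nuL]qform_map -/(q i).
  rewrite !rmorphM !rmorph_nat.
  rewrite -[t (a%:A)]/(tK a) -[t (in_alg L (q i))]/(tK (q i)).
  rewrite normrM normr_nat => le1.
  have le2 : 2 * `|t (s 0 i)| <= 2 * B%:R.
    apply: le_trans le1 _; rewrite /B natrD mulrDr lerD //.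
      rewrite ler_pM2l ?ltr0n //; apply: le_trans (BaP tK).
      by apply: real_ler_norm; apply: K_real.
    apply: le_trans (_ : (Bq i)%:R <= _).
      apply: le_trans (BqP i tK); apply: real_ler_norm; exact: K_real.
    rewrite -natrM ler_nat (bigD1 i) //= mulnDr mul2n -addnn -addnA.
    exact: leq_addr.
  by rewrite ler_pM2l ?ltr0n in le2.
have sr_r i : j (s 0 i) \in r.
  apply: rP; first exact: Aint_integers.
  (* Degrees over the rationals are read off by viewing [L] as an extension of them. *)
  - pose j0 : {rmorphism baseFieldType L -> algC} := j.
    have := size_minCpoly_le_dim j0 (s 0 i).
    suff -> : \dim {:baseFieldType L} = (d * \dim {:K})%N by [].
    rewrite -dimL -dim_baseVspace; congr (\dim _).
    apply/vspaceP => x; rewrite memvf mem_baseVspace.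
    exact/esym/(memvf (x : L)).
  (* A conjugate of [j (s 0 i)] is its image under some [phi], and [phi \o j] is another embedding
     of [L]. *)
  - move=> y /algC_conjugate[phi <-]; exact: (sB (phi \o j)).
have rs (i : 'I_n) : (index (j (s 0%R i)) r < size r)%N by rewrite index_mem.
exists [ffun i => Ordinal (rs i)] => //.
rewrite (range_generated jA genL); congr subring_generated.
by apply/funext => i; rewrite ffunE /= nth_index.
Qed.
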